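(* Let $\mathcal L$ be a semilattice possessing a least element $\ell_0$ and let $(\mathfrak A,(A_\ell)_{\ell\in\mathcal L})$ be an $\mathcal L$-graded $C^*$-algebra. Suppose that the structure morphisms $\varphi_{k,\ell}:A_\ell\to M(A_k)$ satisfy $\varphi_{k,\ell}^{-1}(A_k)=\{0\}$ for all $k,\ell\in\mathcal L$ with $k<\ell$. Then the morphism $\varphi_{\ell_0}=\pi_{\ell_0}:\mathfrak A\to M(A_{\ell_0})$ is injective.
   Context: A semilattice is a partially ordered set $\mathcal L$ in which any two elements $k,\ell$ have a greatest lower bound $k\wedge\ell$. A $C^*$-algebra $\mathfrak A$ is $\mathcal L$-graded with components $(A_i)_{i\in\mathcal L}$, written $(\mathfrak A,(A_i)_{i\in\mathcal L})$, if $(A_i)_{i\in\mathcal L}$ is a family of sub-$C^*$-algebras of $\mathfrak A$ which is linearly independent (if $S_i\in A_i$, only finitely many $S_i$ are nonzero and $\sum_i S_i=0$, then all $S_i=0$), total (the linear span of $\bigcup_i A_i$ is dense in $\mathfrak A$), and satisfies $A_iA_j\subset A_{i\wedge j}$ for all $i,j\in\mathcal L$. $M(A)$ denotes the multiplier algebra of $A$, containing $A$. For $k\le\ell$ the structure morphism $\varphi_{k,\ell}:A_\ell\to M(A_k)$ is given by $\varphi_{k,\ell}(y)x=yx$ for $x\in A_k$, $y\in A_\ell$. Since $\ell_0$ is the least element, $A_{\ell_0}$ is a closed ideal of $\mathfrak A$, and $\varphi_{\ell_0}=\pi_{\ell_0}:\mathfrak A\to M(A_{\ell_0})$ is the resulting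 morphism, $\pi_{\ell_0}(a)x=ax$ for $x\in A_{\ell_0}$. *)

(* Defs.v *)
From HB Require Import structures.
From mathcomp Require Import all_boot all_order all_algebra.
From mathcomp Require Import complex.
From mathcomp Require Import all_classical all_reals all_analysis.

Set Implicit Arguments.
Unset Strict Implicit.
Unset Printing Implicit Defensive.

Import Order.TTheory GRing.Theory Num.Theory.
Import numFieldNormedType.Exports.

Local Open Scope classical_set_scope.
Local Open Scope ring_scope.
Local Open Scope complex_scope.

Reserved Notation "x ** y" (at level 40, left associativity).

(* C*-algebras need not be unital, so the product cannot come from MathComp's
   ring structures, which all have a unit. *)
HB.mixin Record CompleteNormedModule_isCStarAlgebra (R : realType) A
    of CompleteNormedModule R[i] A := {
  cmul : A -> A -> A;
  star : A -> A;
  cmulA : associative cmul;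
  cmulDl : left_distributive cmul +%R;
  cmulDr : right_distributive cmul +%R;
  cmulZl : forall (a : R[i]) (x y : A), cmul (a *: x) y = a *: cmul x y;
  cmulZr : forall (a : R[i]) (x y : A), cmul x (a *: y) = a *: cmul x y;
  starK : involutive star;
  starD : {morph star : x y / x + y};
  starZ : forall (a : R[i]) (x : A), star (a *: x) = Num.conj a *: star x;
  starM : forall x y : A, star (cmul x y) = cmul (star y) (star x);
  norm_cmul : forall x y : A, `|cmul x y| <= `|x| * `|y|;
  norm_star_mul : forall x : A, `|cmul (star x) x| = `|x| ^+ 2
}.

#[short(type="cstarAlgType")]
HB.structure Definition CStarAlgebra (R : realType) :=
  {A of CompleteNormedModule R[i] A & CompleteNormedModule_isCStarAlgebra R A}.

Notation "x ** y" := (cmul x y) : ring_scope.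

Section SubCStarAlgebra.
Variables (R : realType) (A : cstarAlgType R).

Record subCStarAlg := SubCStarAlg {
  sub_car : set A;
  sub_closed : closed sub_car;
  sub_0 : sub_car 0;
  sub_D : forall x y, sub_car x -> sub_car y -> sub_car (x + y);
  sub_Z : forall (a : R[i]) x, sub_car x -> sub_car (a *: x);
  sub_mul : forall x y, sub_car x -> sub_car y -> sub_car (x ** y);
  sub_star : forall x, sub_car x -> sub_car (star x)
}.

Variable B : subCStarAlg.

(* B with the operations and the norm of A is again a C*-algebra, so that M(B)
   below is the multiplier algebra of B itself. *)
Definition sub_pred : pred A := fun x => x \in sub_car B.

Record sub_type := SubType { sub_val : A; _ : sub_val \in sub_pred }.

HB.instance Definition _ := [isSub for sub_val].
HB.instance Definition _ := [Choice of sub_type by <:].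

Fact sub_predP x : reflect (sub_car B x) (x \in sub_pred).
Proof. by apply: (iffP idP) => [/set_mem|/mem_set]. Qed.

Fact sub_submod_closed : submod_closed sub_pred.
Proof.
split; first exact/sub_predP/sub_0.
move=> a x y /sub_predP Bx /sub_predP By.
exact/sub_predP/sub_D/By/sub_Z.
Qed.

HB.instance Definition _ :=
  GRing.isSubmodClosed.Build R[i] A sub_pred sub_submod_closed.
HB.instance Definition _ := [SubChoice_isSubLmodule of sub_type by <:].

Fact sub_ler_normD (x y : sub_type) :
  `|val (x + y)| <= `|val x| + `|val y|.
Proof. by rewrite raddfD ler_normD. Qed.

Fact sub_normrZ (a : R[i]) (x : sub_type) : `|val (a *: x)| = `|a| * `|val x|.
Proof. by rewrite linearZ normrZ. Qed.

Fact sub_normr0_eq0 (x : sub_type) : `|val x| = 0 -> x = 0.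
Proof. by move=> /normr0_eq0 x0; apply: val_inj; rewrite x0 raddf0. Qed.

HB.instance Definition _ := Lmodule_isNormed.Build R[i] sub_type
  sub_ler_normD sub_normrZ sub_normr0_eq0.

Fact sub_normE (x : sub_type) : `|x| = `|val x|.
Proof. by []. Qed.

Fact sub_complete (F : set_system sub_type) :
  ProperFilter F -> cauchy F -> cvg F.
Proof.
move=> FF Fc.
have FFv : ProperFilter (val @ F) by exact: fmap_proper_filter.
have Fvc : cauchy (val @ F).
  apply/cauchy_ballP => e e0; move/cauchy_ballP : Fc => /(_ _ e0).
  rewrite /fmap; case => -[U V]/= [FU FV] UV.
  exists (val @` U, val @` V) => /=.
    by split; [apply: filterS FU|apply: filterS FV] => z Uz /=; exists z.
  move=> [_ _]/= [[u Uu <-] [v Vv <-]].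
  have /= := UV (u, v) (conj Uu Vv).
  by rewrite -!ball_normE /= sub_normE raddfB.
have /cvg_ex [x Fx] : cvg (val @ F) by exact: cauchy_cvg.
have Bx : sub_car B x.
  apply: (@closed_cvg _ _ F FF val (sub_car B)) Fx; first exact: sub_closed.
  by apply: nearW => z; exact/sub_predP/(valP z).
apply/cvg_ex; exists (Sub x (introT (sub_predP x) Bx) : sub_type).
apply/cvgrPdist_lt => e e0.
move/cvgrPdist_lt : Fx => /(_ _ e0); apply: filterS => z.
by rewrite sub_normE raddfB.
Qed.

HB.instance Definition _ := Uniform_isComplete.Build sub_type sub_complete.

Definition insub_alg (x : A) (Bx : sub_car B x) : sub_type :=
  Sub x (introT (sub_predP x) Bx).

Fact val_sub_car (x : sub_type) : sub_car B (val x).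
Proof. exact/sub_predP/(valP x). Qed.

Definition sub_cmul (x y : sub_type) : sub_type :=
  insub_alg (sub_mul (val_sub_car x) (val_sub_car y)).

Definition sub_cstar (x : sub_type) : sub_type :=
  insub_alg (sub_star (val_sub_car x)).

Fact sub_cmulA : associative sub_cmul.
Proof. by move=> x y z; apply: val_inj; rewrite /= cmulA. Qed.
Fact sub_cmulDl : left_distributive sub_cmul +%R.
Proof. by move=> x y z; apply: val_inj; rewrite /= cmulDl. Qed.
Fact sub_cmulDr : right_distributive sub_cmul +%R.
Proof. by move=> x y z; apply: val_inj; rewrite /= cmulDr. Qed.
Fact sub_cmulZl (a : R[i]) x y : sub_cmul (a *: x) y = a *: sub_cmul x y.
Proof. by apply: val_inj; rewrite /= cmulZl. Qed.
Fact sub_cmulZr (a : R[i]) x y : sub_cmul x (a *: y) = a *: sub_cmul x y.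
Proof. by apply: val_inj; rewrite /= cmulZr. Qed.
Fact sub_starK : involutive sub_cstar.
Proof. by move=> x; apply: val_inj; rewrite /= starK. Qed.
Fact sub_starD : {morph sub_cstar : x y / x + y}.
Proof. by move=> x y; apply: val_inj; rewrite /= starD. Qed.
Fact sub_starZ (a : R[i]) x : sub_cstar (a *: x) = Num.conj a *: sub_cstar x.
Proof. by apply: val_inj; rewrite /= starZ. Qed.
Fact sub_starM x y :
  sub_cstar (sub_cmul x y) = sub_cmul (sub_cstar y) (sub_cstar x).
Proof. by apply: val_inj; rewrite /= starM. Qed.
Fact sub_norm_cmul x y : `|sub_cmul x y| <= `|x| * `|y|.
Proof. exact: norm_cmul. Qed.
Fact sub_norm_star_mul x : `|sub_cmul (sub_cstar x) x| = `|x| ^+ 2.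
Proof. exact: norm_star_mul. Qed.

HB.instance Definition _ := CompleteNormedModule_isCStarAlgebra.Build R sub_type
  sub_cmulA sub_cmulDl sub_cmulDr sub_cmulZl sub_cmulZr
  sub_starK sub_starD sub_starZ sub_starM sub_norm_cmul sub_norm_star_mul.

End SubCStarAlgebra.


Coercion sub_type : subCStarAlg >-> Sortclass.

Section Multiplier.
Variables (R : realType) (A : cstarAlgType R).

(* The elements of the multiplier algebra M(A), as double centralizers; an
   adjointable operator T of the Hilbert A-module A is the pair with mult_l = T
   and mult_r x = star (T^* (star x)). *)
Record multiplier := Multiplier {
  mult_l : A -> A;
  mult_r : A -> A;
  mult_l_linear : linear mult_l;
  mult_r_linear : linear mult_r;
  mult_l_bounded : exists C : R[i], forall x, `|mult_l x| <= C * `|x|;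
  mult_r_bounded : exists C : R[i], forall x, `|mult_r x| <= C * `|x|;
  mult_l_mul : forall x y, mult_l (x ** y) = mult_l x ** y;
  mult_r_mul : forall x y, mult_r (x ** y) = x ** mult_r y;
  mult_rl : forall x y, mult_r x ** y = x ** mult_l y
}.

Fact cmul_linear (a : A) : linear (cmul a).
Proof. by move=> c x y; rewrite cmulDr cmulZr. Qed.

Fact cmulr_linear (a : A) : linear (cmul^~ a).
Proof. by move=> c x y; rewrite cmulDl cmulZl. Qed.

Fact cmul_bounded (a : A) : exists C : R[i], forall x, `|a ** x| <= C * `|x|.
Proof. by exists `|a| => x; exact: norm_cmul. Qed.

Fact cmulr_bounded (a : A) : exists C : R[i], forall x, `|x ** a| <= C * `|x|.
Proof. by exists `|a| => x; rewrite mulrC; exact: norm_cmul. Qed.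

Fact cmulA' (a x y : A) : a ** (x ** y) = a ** x ** y.
Proof. exact: cmulA. Qed.

Fact cmulrA' (a x y : A) : x ** y ** a = x ** (y ** a).
Proof. by rewrite cmulA. Qed.

Definition multiplier_emb (a : A) : multiplier :=
  @Multiplier (cmul a) (cmul^~ a) (cmul_linear a) (cmulr_linear a)
    (cmul_bounded a) (cmulr_bounded a) (cmulA' a) (cmulrA' a)
    (fun x y => esym (cmulA x a y)).

End Multiplier.

Section SubMultiplier.
Variables (R : realType) (A : cstarAlgType R) (B : subCStarAlg A) (a : A).

Definition idealizes :=
  (forall x, sub_car B x -> sub_car B (a ** x)) /\
  (forall x, sub_car B x -> sub_car B (x ** a)).

Hypothesis aB : idealizes.

Definition sub_mult_l (x : B) : B := insub_alg (aB.1 _ (val_sub_car x)).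
Definition sub_mult_r (x : B) : B := insub_alg (aB.2 _ (val_sub_car x)).

Fact sub_mult_l_linear : linear sub_mult_l.
Proof. by move=> c x y; apply: val_inj; rewrite /= cmulDr cmulZr. Qed.

Fact sub_mult_r_linear : linear sub_mult_r.
Proof. by move=> c x y; apply: val_inj; rewrite /= cmulDl cmulZl. Qed.

Fact sub_mult_l_bounded :
  exists C : R[i], forall x, `|sub_mult_l x| <= C * `|x|.
Proof. by exists `|a| => x; exact: norm_cmul. Qed.

Fact sub_mult_r_bounded :
  exists C : R[i], forall x, `|sub_mult_r x| <= C * `|x|.
Proof. by exists `|a| => x; rewrite mulrC; exact: norm_cmul. Qed.

Fact sub_mult_l_mul (x y : B) : sub_mult_l (x ** y) = sub_mult_l x ** y.
Proof. by apply: val_inj; rewrite /= cmulA. Qed.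

Fact sub_mult_r_mul (x y : B) : sub_mult_r (x ** y) = x ** sub_mult_r y.
Proof. by apply: val_inj; rewrite /= cmulA. Qed.

Fact sub_mult_rl (x y : B) : sub_mult_r x ** y = x ** sub_mult_l y.
Proof. by apply: val_inj; rewrite /= cmulA. Qed.

Definition sub_multiplier : multiplier B :=
  Multiplier sub_mult_l_linear sub_mult_r_linear
    sub_mult_l_bounded sub_mult_r_bounded
    sub_mult_l_mul sub_mult_r_mul sub_mult_rl.

End SubMultiplier.

Definition lin_span (K : pzRingType) (V : lmodType K) (S : set V) : set V :=
  [set x | exists (n : nat) (c : 'I_n -> K) (v : 'I_n -> V),
    (forall i, S (v i)) /\ x = \sum_(i < n) c i *: v i].

(* The sum over [set: L] in graded_indep is the library's finitely supported sum,
   equal to 0 by convention when the support is infinite. *)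
Record graded (R : realType) (d : Order.disp_t) (L : meetSemilatticeType d)
    (A : cstarAlgType R) (A_ : L -> subCStarAlg A) : Prop := Graded {
  graded_indep : forall S : L -> A,
    (forall i, sub_car (A_ i) (S i)) ->
    finite_set [set i | S i != 0] ->
    \sum_(i \in [set: L]) S i = 0 ->
    forall i, S i = 0;
  graded_total : dense (lin_span (\bigcup_i sub_car (A_ i)));
  graded_mul : forall (i j : L) (x y : A),
    sub_car (A_ i) x -> sub_car (A_ j) y -> sub_car (A_ (Order.meet i j)) (x ** y)
}.

Section StructureMorphism.
Variables (R : realType) (d : Order.disp_t) (L : meetSemilatticeType d).
Variables (A : cstarAlgType R) (A_ : L -> subCStarAlg A) (grA : graded A_).

Fact graded_idealizes (k l : L) : (k <= l)%O ->
  forall y, sub_car (A_ l) y -> idealizes (A_ k) y.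
Proof.
move=> /meet_idPl kl y Ay; split=> x Ax.
- by have := graded_mul grA Ay Ax; rewrite meetC kl.
- by have := graded_mul grA Ax Ay; rewrite kl.
Qed.

Definition structure_morphism (k l : L) (kl : (k <= l)%O) (y : A_ l) :
    multiplier (A_ k) :=
  sub_multiplier (graded_idealizes kl (val_sub_car y)).

End StructureMorphism.

Section BottomMorphism.
Variables (R : realType) (d : Order.disp_t) (L : bMeetSemilatticeType d).
Variables (A : cstarAlgType R) (A_ : L -> subCStarAlg A) (grA : graded A_).

Local Notation I := (A_ Order.bottom).

Lemma span_idealizes (a : A) :
  lin_span (\bigcup_i sub_car (A_ i)) a -> idealizes I a.
Proof.
move=> [n [c [v [Sv ->]]]]; split=> x Ix.
- elim/big_ind : _ => [|u w Iu Iw|i _].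
  + by rewrite -(scale0r (0 : A)) cmulZl scale0r; exact: sub_0.
  + by rewrite cmulDl; exact: sub_D.
  + rewrite cmulZl; apply: sub_Z; have [j _ Aj] := Sv i.
    by have := graded_mul grA Aj Ix; rewrite meetx0.
- elim/big_ind : _ => [|u w Iu Iw|i _].
  + by rewrite -(scale0r (0 : A)) cmulZr scale0r; exact: sub_0.
  + by rewrite cmulDr; exact: sub_D.
  + rewrite cmulZr; apply: sub_Z; have [j _ Aj] := Sv i.
    by have := graded_mul grA Ix Aj; rewrite meet0x.
Qed.

Lemma bottom_idealizes (a : A) : idealizes I a.
Proof.
have approx (x : A) (e : R[i]) : 0 < e ->
    exists2 b, lin_span (\bigcup_i sub_car (A_ i)) b & `|a - b| * `|x| < e.
  move=> e0; have x1 : 0 < `|x| + 1 by rewrite ltr_wpDl.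
  have e1 : 0 < e / (`|x| + 1) by rewrite divr_gt0.
  have [||b [+ Sb]] := graded_total grA (O := ball a (e / (`|x| + 1))).
  - by exists a; exact: ballxx.
  - exact: ball_open.
  - rewrite -ball_normE /= => ab; exists b => //.
    move: ab; rewrite ltr_pdivlMr//; apply: le_lt_trans.
    by rewrite ler_wpM2l// lerDl.
split=> x Ix; apply: (@sub_closed _ _ I) => U /nbhs_ballP[e /= e0 eU].
- have [b /span_idealizes Sb abe] := approx x e e0.
  exists (b ** x); split; first exact: Sb.1.
  apply: eU; rewrite -ball_normE /=; apply: le_lt_trans abe.
  rewrite -(scaleN1r (b ** x)) -cmulZl -cmulDl scaleN1r; exact: norm_cmul.
- have [b /span_idealizes Sb abe] := approx x e e0.
  exists (x ** b); split; first exact: Sb.2.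
  apply: eU; rewrite -ball_normE /=; apply: le_lt_trans abe.
  rewrite -(scaleN1r (x ** b)) -cmulZr -cmulDr scaleN1r mulrC.
  exact: norm_cmul.
Qed.

Definition bottom_morphism (a : A) : multiplier I :=
  sub_multiplier (bottom_idealizes a).

End BottomMorphism.

(* Main.v *)
Require Import Defs.
From HB Require Import structures.
From mathcomp Require Import all_boot all_order all_algebra.
From mathcomp Require Import complex ring lra.
From mathcomp Require Import all_classical all_reals all_analysis.

Set Implicit Arguments.
Unset Strict Implicit.
Unset Printing Implicit Defensive.

Import Order.TTheory GRing.Theory Num.Theory.
Import numFieldNormedType.Exports.

Local Open Scope classical_set_scope.
Local Open Scope ring_scope.

(** Let [J] be the closed ideal of all [a] that annihilate the least component
    from both sides; it is the kernel of the morphism, and the claim is [J = 0].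
    Two things have to be combined.

    Algebra. For a finite set [s] of indices stable under meets, the sum of the
    components over [s] meets [J] trivially ([gsum_annihilator]). Remove a
    maximal index [l] from [s]. If [a] annihilates the least component and [x]
    is in [A_ l], then [a x] annihilates, by induction, every component strictly
    below [l]; comparing the components of [a x y] for [y] in [A_ m], with [m]
    maximal among the indices below [l], shows that the [l]-component of [a x]
    acts on [A_ m] as an element of [A_ m], so it vanishes by hypothesis.

    Analysis. If a C*-subalgebra [B] normalizes a closed ideal [I] and meets it
    trivially, then the map from [B] to the quotient by [I] is isometric, that
    is, [|b| <= |b - i|] ([dist_ideal]). Used with [I] a sum over fewer indices
    it shows, by induction, that the finite sums are closed ([gsum_closed]), so
    that they are C*-algebras; used with [I = J] and [B] a finite sum it shows
    that an element of [J] at distance less than [e] from [B] has norm less than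
    [2 e], and density concludes ([annihilator_eq0]).

    The usual proof of [dist_ideal] applies a continuous function to a
    self-adjoint element. Only the function [max(0, t - rho)] is used here, and
    it is obtained by iterating polynomials converging to a square root; the norm
    estimates come from the inequality [|P|^2 <= |P^* P + V^* V|], valid when
    [P^* V = V^* P] ([nm_commuting_squares]), in place of spectral theory. *)

(** * The real-valued norm of a C*-algebra *)

Section RealNorm.
Variables (R : realType) (A : cstarAlgType R).
Implicit Types x y z : A.
Local Open Scope complex_scope.

(** The norm has values in the nonnegative elements of [R[i]]; its real part
    carries the same information and is totally ordered. *)
Definition nm x : R := complex.Re `|x|.

Lemma nmE x : `|x| = (nm x)%:C.
Proof. by rewrite /nm RRe_real// ger0_real. Qed.

Lemma nm_ge0 x : 0 <= nm x.
Proof. by rewrite -ler0c -nmE. Qed.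

Lemma nm0 : nm 0 = 0.
Proof. by rewrite /nm normr0. Qed.

Lemma nm_eq0 x : nm x = 0 -> x = 0.
Proof. by move=> x0; apply: normr0_eq0; rewrite nmE x0. Qed.

Lemma nmD x y : nm (x + y) <= nm x + nm y.
Proof. by rewrite -lecR rmorphD /= -!nmE ler_normD. Qed.

Lemma nmN x : nm (- x) = nm x.
Proof. by rewrite /nm normrN. Qed.

Lemma nmB x y : nm (x - y) = nm (y - x).
Proof. by rewrite -nmN opprB. Qed.

Lemma nmM x y : nm (x ** y) <= nm x * nm y.
Proof. by rewrite -lecR rmorphM /= -!nmE norm_cmul. Qed.

Lemma nm_star_mul x : nm (star x ** x) = nm x ^+ 2.
Proof. by apply: (@complexI R); rewrite rmorphXn /= -!nmE norm_star_mul. Qed.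

Lemma nmZ (r : R) x : nm (r%:C *: x) = `|r| * nm x.
Proof.
apply: (@complexI R); rewrite rmorphM /= -!nmE normrZ; congr (_ * _).
by rewrite normc_def /= expr0n addr0; congr (_%:C); exact: sqrtr_sqr.
Qed.

Lemma cmul0l x : 0 ** x = 0 :> A.
Proof. by rewrite -(scale0r (0 : A)) cmulZl !scale0r. Qed.

Lemma cmul0r x : x ** 0 = 0 :> A.
Proof. by rewrite -(scale0r (0 : A)) cmulZr !scale0r. Qed.

Lemma cmulNl x y : (- x) ** y = - (x ** y).
Proof. by apply/eqP; rewrite -addr_eq0 -cmulDl addNr cmul0l. Qed.

Lemma cmulNr x y : x ** (- y) = - (x ** y).
Proof. by apply/eqP; rewrite -addr_eq0 -cmulDr addNr cmul0r. Qed.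

Lemma cmulBl x y z : (x - y) ** z = x ** z - y ** z.
Proof. by rewrite cmulDl cmulNl. Qed.

Lemma cmulBr x y z : x ** (y - z) = x ** y - x ** z.
Proof. by rewrite cmulDr cmulNr. Qed.

Lemma star0 : star 0 = 0 :> A.
Proof. by rewrite -(scale0r (0 : A)) starZ rmorph0 !scale0r. Qed.

Lemma starN x : star (- x) = - star x.
Proof. by apply/eqP; rewrite -addr_eq0 -starD addNr star0. Qed.

Lemma starZR (r : R) x : star (r%:C *: x) = r%:C *: star x.
Proof. by rewrite starZ; congr (_ *: _); exact: conjc_real. Qed.

Lemma starZi x : star ('i *: x) = - ('i *: star x).
Proof.
by rewrite starZ -scaleNr; congr (_ *: _); rewrite /= /Num.conj /=; simpc.
Qed.

Lemma nm_star x : nm (star x) = nm x.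
Proof.
suff le y : nm y <= nm (star y).
  by apply/le_anti; rewrite le -{2}(starK x) le.
have [->|y0] := eqVneq (nm y) 0; first exact: nm_ge0.
have yp : 0 < nm y by rewrite lt_neqAle eq_sym y0 nm_ge0.
by rewrite -(ler_pM2r yp) -expr2 -nm_star_mul nmM.
Qed.

Lemma ball_nm x y (e : R) : ball x e%:C y <-> nm (x - y) < e.
Proof. by rewrite -ball_normE /= nmE ltcR. Qed.

Lemma posC_nm (e : R[i]) : 0 < e -> exists2 r : R, 0 < r & e = r%:C.
Proof.
move=> e0; exists (complex.Re e); first by rewrite -ltcR RRe_real ?gtr0_real.
by rewrite RRe_real ?gtr0_real.
Qed.

Lemma nm_closed (S : set A) x : closed S ->
  (forall e : R, 0 < e -> exists2 y, S y & nm (x - y) < e) -> S x.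
Proof.
move=> cS ap; apply: cS => U /nbhs_ballP[_ /= /posC_nm[e e0 ->] eU].
have [y Sy /ball_nm ye] := ap e e0.
by exists y; split => //; exact: eU.
Qed.

Lemma closed_nm (S : set A) :
  (forall x, (forall e : R, 0 < e -> exists2 y, S y & nm (x - y) < e) -> S x) ->
  closed S.
Proof.
move=> h x clx; apply: h => e e0.
have /clx[y [Sy /ball_nm xy]] : nbhs x (ball x e%:C).
  by apply: nbhsx_ballx; rewrite ltcR.
by exists y.
Qed.

Lemma nm_complete (u : nat -> A) :
  (forall e : R, 0 < e ->
     exists N, forall m n, (N <= m)%N -> (N <= n)%N -> nm (u m - u n) < e) ->
  exists l, forall e : R, 0 < e ->
     exists N, forall n, (N <= n)%N -> nm (u n - l) < e.
Proof.
move=> uc.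
have /cauchy_cvg/cvg_ex[l ul] : cauchy (u @ \oo).
  apply/cauchy_ballP => _ /posC_nm[e e0 ->].
  have [N hN] := uc e e0.
  exists (u @` [set n | (N <= n)%N], u @` [set n | (N <= n)%N]) => /=.
    by split; exists N => // n /= Nn; exists n.
  by move=> [_ _] /= [[m Nm <-] [n Nn <-]]; apply/ball_nm/hN.
exists l => e e0.
have /cvgrPdist_lt/(_ e%:C) := ul; rewrite ltcR => /(_ e0) [N _ hN].
by exists N => n /hN /=; rewrite nmE ltcR nmB.
Qed.

(** Multiplying out the norm of [P + iV] makes the cross terms cancel, and
    [P] is the mean of [P + iV] and [P - iV]. This inequality stands in for the
    order on self-adjoint elements. *)
Lemma nm_commuting_squares (P V : A) : star P ** V = star V ** P ->
  nm P ^+ 2 <= nm (star P ** P + star V ** V).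
Proof.
move=> PV.
have ii x : 'i *: ('i *: x) = - x.
  by rewrite scalerA -expr2 sqr_i scaleN1r.
have mean (W : A) : star P ** W = star W ** P ->
    nm (P + 'i *: W) ^+ 2 = nm (star P ** P + star W ** W).
  move=> PW; rewrite -nm_star_mul starD starZi cmulDl !cmulDr !cmulNl.
  rewrite !cmulZl !cmulZr ii opprK PW; congr nm.
  by rewrite addrA -(addrA _ ('i *: _)) subrr addr0.
have h1 := mean V PV.
have h2 := mean (- V); rewrite cmulNr starN !cmulNl cmulNr PV opprK scalerN in h2.
have {}h2 := h2 erefl.
move: (nm (star P ** P + _)) h1 h2 => M h1 h2.
have e2 : P + P = (P + 'i *: V) + (P - 'i *: V).
  by rewrite addrACA subrr addr0.
have := nmD (P + 'i *: V) (P - 'i *: V); rewrite -e2.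
have -> : nm (P + P) = 2 * nm P.
  have -> : P + P = (2 : R)%:C *: P by rewrite rmorphD /= scalerDl scale1r.
  by rewrite nmZ ger0_norm.
have := nm_ge0 (P + 'i *: V); have := nm_ge0 (P - 'i *: V).
have := nm_ge0 P.
move: (nm (P + _)) (nm (P - _)) (nm P) h1 h2 => a b c h1 h2 c0 b0 a0 le.
have ab : a = b by apply/eqP; rewrite -(eqrXn2 (n := 2))// h1 h2.
rewrite -h1; subst b; rewrite ler_sqr ?nnegrE//; lra.
Qed.

End RealNorm.

(** * Polynomials acting on the algebra, and square roots *)

Section PolyEval.
Variables (R : realType) (A : cstarAlgType R).
Implicit Types (x y z : A) (p q : {poly R}).
Local Open Scope complex_scope.

(** The action of [p(x)] on [z]. If [p] has a constant term then [p(x)] itself is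
    only an element of the unitization, but it still acts on [A]. *)
Definition ev x p z : A :=
  \sum_(i < size p) (p`_i)%:C *: iter i (cmul x) z.

Lemma ev_widen n x p z : (size p <= n)%N ->
  ev x p z = \sum_(i < n) (p`_i)%:C *: iter i (cmul x) z.
Proof.
move=> pn; rewrite /ev (big_ord_widen n (fun i => (p`_i)%:C *: iter i (cmul x) z))//.
rewrite big_mkcond; apply: eq_bigr => i _; case: ltnP => // /(nth_default 0) ->.
by rewrite scale0r.
Qed.

Lemma evD x p q z : ev x (p + q) z = ev x p z + ev x q z.
Proof.
rewrite !(@ev_widen (maxn (size p) (size q))) ?leq_maxl ?leq_maxr ?size_polyD//.
by rewrite -big_split; apply: eq_bigr => i _; rewrite coefD rmorphD scalerDl.
Qed.

Lemma evZ x (r : R) p z : ev x (r *: p) z = r%:C *: ev x p z.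
Proof.
rewrite (@ev_widen (size p)) ?size_scale_leq// scaler_sumr.
by apply: eq_bigr => i _; rewrite coefZ rmorphM scalerA.
Qed.

Lemma evN x p z : ev x (- p) z = - ev x p z.
Proof. by rewrite -scaleN1r evZ rmorphN1 scaleN1r. Qed.

Lemma evB x p q z : ev x (p - q) z = ev x p z - ev x q z.
Proof. by rewrite evD evN. Qed.

Lemma evC x (c : R) z : ev x c%:P z = c%:C *: z.
Proof.
by rewrite (@ev_widen 1) ?size_polyC_leq1// big_ord1 coefC.
Qed.

Lemma ev1 x z : ev x 1 z = z.
Proof. by rewrite -[1]/(1%:P) evC scale1r. Qed.

Lemma cmul_sumr I (s : seq I) (F : I -> A) x :
  x ** (\sum_(i <- s) F i) = \sum_(i <- s) x ** F i.
Proof.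
by elim/big_rec2 : _ => [|i u v _ <-]; rewrite ?cmul0r ?cmulDr.
Qed.

Lemma evMX x p z : ev x (p * 'X) z = x ** ev x p z.
Proof.
rewrite (@ev_widen (size p).+1); last first.
  by rewrite (leq_trans (size_polyMleq _ _))// size_polyX addn2.
rewrite big_ord_recl coefMX /= scale0r add0r /ev cmul_sumr.
by apply: eq_bigr => i _; rewrite coefMX /= cmulZr.
Qed.

Lemma evX x z : ev x 'X z = x ** z.
Proof. by rewrite -(mul1r 'X) evMX ev1. Qed.

Lemma evM x p q z : ev x (p * q) z = ev x p (ev x q z).
Proof.
elim/poly_ind : p => [|p c IH]; first by rewrite mul0r -[0]/(0%:P) !evC !scale0r.
rewrite mulrDl !evD evMX evC -IH mul_polyC evZ.
by rewrite mulrAC evMX.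
Qed.

Lemma ev_comm h x p z : h ** x = x ** h -> h ** ev x p z = ev x p (h ** z).
Proof.
move=> hx; elim/poly_ind : p => [|p c IH].
  by rewrite -[0]/(0%:P) !evC !scale0r cmul0r.
by rewrite !evD !evMX !evC cmulDr cmulZr -IH !cmulA hx.
Qed.

Lemma ev_star x p z y : star x = x -> star (ev x p z) ** y = star z ** ev x p y.
Proof.
move=> sx; elim/poly_ind : p y => [|p c IH] y.
  by rewrite -[0]/(0%:P) !evC !scale0r star0 cmul0l cmul0r.
rewrite !evD !evMX !evC starD starM starZR cmulDl cmulDr cmulZl cmulZr sx.
by rewrite -cmulA IH -(ev_comm p y (erefl (x ** x))).
Qed.

(** A bound on the norm of [p(x)] in the unitization of [A], expressed by its
    action on [A]. *)
Definition opnorm_le x p (M : R) := forall z, nm (ev x p z) <= M * nm z.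

Lemma opnorm_le_trans x p (M M' : R) :
  opnorm_le x p M -> M <= M' -> opnorm_le x p M'.
Proof. by move=> h MM z; apply: le_trans (h z) _; rewrite ler_wpM2r ?nm_ge0. Qed.

Lemma opnormD x p q (M M' : R) :
  opnorm_le x p M -> opnorm_le x q M' -> opnorm_le x (p + q) (M + M').
Proof.
move=> hp hq z; rewrite evD mulrDl; apply: le_trans (nmD _ _) _.
by rewrite lerD.
Qed.

Lemma opnormM x p q (M M' : R) : 0 <= M ->
  opnorm_le x p M -> opnorm_le x q M' -> opnorm_le x (p * q) (M * M').
Proof.
move=> M0 hp hq z; rewrite evM; apply: le_trans (hp _) _.
by rewrite -mulrA ler_wpM2l.
Qed.

Lemma opnormZ x (r : R) p M : 0 <= r ->
  opnorm_le x p M -> opnorm_le x (r *: p) (r * M).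
Proof. by move=> r0 hp z; rewrite evZ nmZ ger0_norm// -mulrA ler_wpM2l. Qed.

Lemma opnormN x p M : opnorm_le x p M -> opnorm_le x (- p) M.
Proof. by move=> hp z; rewrite evN nmN. Qed.

Lemma opnormC x (c : R) : 0 <= c -> opnorm_le x c%:P c.
Proof. by move=> c0 z; rewrite evC nmZ ger0_norm. Qed.

Lemma opnormX x : opnorm_le x 'X (nm x).
Proof. by move=> z; rewrite evX nmM. Qed.

Lemma opnorm_closed x p (M : R) :
  (forall e, 0 < e -> opnorm_le x p (M + e)) -> opnorm_le x p M.
Proof.
move=> h z; apply/ler_addgt0Pr => e e0.
have n1 : 0 < nm z + 1 by rewrite ltr_wpDl ?nm_ge0.
have /h/(_ z) : 0 < e / (nm z + 1) by rewrite divr_gt0.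
move=> /le_trans; apply; rewrite mulrDl lerD2l mulrAC ler_pdivrMr//.
by rewrite ler_pM2l// lerDl.
Qed.

(** The iterates of [w = (q + w^2) / 2], whose fixed point satisfies
    [(1 - w)^2 = 1 - q]. *)
Fixpoint sqrt_iter q n : {poly R} :=
  if n is m.+1 then (2^-1 : R) *: (q + sqrt_iter q m ^+ 2) else 0.

(** The same iteration at the scalar [q = 1]. *)
Fixpoint sqrt_iter_bound n : R :=
  if n is m.+1 then 2^-1 * (1 + sqrt_iter_bound m ^+ 2) else 0.

Local Notation om := sqrt_iter_bound.

Lemma om_itv n : 0 <= om n <= 1.
Proof.
elim: n => [|n /andP[h0 h1]] /=; first by rewrite lexx ler01.
have : om n ^+ 2 <= 1 by rewrite expr_le1.
have := sqr_ge0 (om n); nra.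
Qed.

(** An explicit rate of convergence to [1]; with [k = n + 2] the induction step
    amounts to [(k - 1) (k + 1) <= k^2]. *)
Lemma om_ge n : 1 - 2 / n.+2%:R <= om n.
Proof.
elim: n => [|n IH] /=; first by rewrite divff// subrr.
have /andP[h0 h1] := om_itv n.
have n0 : 0 <= n%:R :> R by [].
have e2 : n.+2%:R = n%:R + 2 :> R by rewrite -addn2 natrD.
have e3 : n.+3%:R = n%:R + 3 :> R by rewrite -addn3 natrD.
move: IH; rewrite e2 e3; move: (om n) (n%:R) n0 h0 h1 => w k k0 w0 w1 IH.
have dk : 0 <= 1 - 2 / (k + 2) by rewrite subr_ge0 ler_pdivrMr; lra.
have sq : (1 - 2 / (k + 2)) ^+ 2 <= w ^+ 2 by rewrite ler_sqr ?nnegrE.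
apply: (@le_trans _ _ (2^-1 * (1 + (1 - 2 / (k + 2)) ^+ 2))); last first.
  by rewrite ler_pM2l// lerD2l.
rewrite -subr_ge0.
have -> : 2^-1 * (1 + (1 - 2 / (k + 2)) ^+ 2) - (1 - 2 / (k + 3)) =
  2 / ((k + 2) ^+ 2 * (k + 3)).
  by field; apply/andP; split; apply: lt0r_neq0; lra.
by rewrite divr_ge0// mulr_ge0 ?sqr_ge0//; lra.
Qed.

Lemma sqrt_iter_step q n : sqrt_iter q n.+1 = (2^-1 : R) *: (q + sqrt_iter q n ^+ 2).
Proof. by []. Qed.

Lemma om_step n : om n.+1 = 2^-1 * (1 + om n ^+ 2).
Proof. by []. Qed.

Lemma opnorm_sqrt_iter x q n : opnorm_le x q 1 -> opnorm_le x (sqrt_iter q n) (om n).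
Proof.
move=> hq; elim: n => [|n IH].
  by move=> z; rewrite -[sqrt_iter _ _]/(0%:P) evC scale0r nm0 mul0r.
rewrite sqrt_iter_step om_step; apply: opnormZ; first by rewrite invr_ge0.
have /andP[h0 _] := om_itv n.
by apply: opnormD => //; rewrite !expr2; apply: opnormM.
Qed.

Lemma opnorm_sqrt_iter1 x q n : opnorm_le x q 1 -> opnorm_le x (sqrt_iter q n) 1.
Proof.
move=> /(opnorm_sqrt_iter n)/opnorm_le_trans; apply.
by case/andP : (om_itv n).
Qed.

(** Consecutive differences satisfy [w'' - w' = (w' - w) (w' + w) / 2], which
    bounds them by their values at [q = 1]. *)
Lemma opnorm_sqrt_iterS x q n : opnorm_le x q 1 ->
  opnorm_le x (sqrt_iter q n.+1 - sqrt_iter q n) (om n.+1 - om n).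
Proof.
move=> hq; elim: n => [|n IH].
  rewrite /= !subr0; have := opnorm_sqrt_iter 1 hq; by [].
rewrite (sqrt_iter_step q n.+1) (om_step n.+1).
have -> : (2^-1 : R) *: (q + sqrt_iter q n.+1 ^+ 2) - sqrt_iter q n.+1 =
  (2^-1 : R) *: ((sqrt_iter q n.+1 - sqrt_iter q n) *
                 (sqrt_iter q n.+1 + sqrt_iter q n)).
  by rewrite {2}sqrt_iter_step -scalerBr; congr (_ *: _); ring.
have -> : 2^-1 * (1 + om n.+1 ^+ 2) - om n.+1 =
  2^-1 * ((om n.+1 - om n) * (om n.+1 + om n)).
  by rewrite {2}om_step; ring.
apply: opnormZ; first by rewrite invr_ge0.
apply: opnormM => //; last by apply: opnormD; exact: opnorm_sqrt_iter.
by rewrite om_step; have := sqr_ge0 (1 - om n); nra.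
Qed.

Lemma opnorm_sqrt_iterB x q m n : opnorm_le x q 1 ->
  opnorm_le x (sqrt_iter q (n + m) - sqrt_iter q n) (2 / n.+2%:R).
Proof.
move=> hq; apply: (@opnorm_le_trans _ _ (om (n + m) - om n)); last first.
  have := om_ge n; have /andP[_] := om_itv (n + m).
  by move: (om _) (om n) (2 / _) => a b c; lra.
elim: m => [|m IH].
  by rewrite addn0 !subrr => z; rewrite -[0]/(0%:P) evC scale0r nm0 mul0r.
rewrite addnS; have := opnormD (opnorm_sqrt_iterS (n + m) hq) IH.
by rewrite !addrA !subrK.
Qed.

Lemma sqrt_iter_cauchy x q (e : R) : opnorm_le x q 1 -> 0 < e ->
  exists N, forall m n, (N <= m)%N -> (N <= n)%N ->
    opnorm_le x (sqrt_iter q m - sqrt_iter q n) e.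
Proof.
move=> hq e0; exists (Num.truncn (2 / e)) => m n.
wlog nm : m n / (n <= m)%N => [hw|Nm Nn].
  have [nm|mn] := leqP n m; first exact: hw.
  by move=> Nm Nn; rewrite -opprB; apply: opnormN; apply: hw => //; exact: ltnW.
rewrite -(subnKC nm); apply: opnorm_le_trans (opnorm_sqrt_iterB _ _ hq) _.
rewrite ler_pdivrMr// mulrC -ler_pdivrMr//.
apply: ltW; apply: lt_le_trans (truncnS_gt _) _.
by rewrite ler_nat !ltnS ltnW.
Qed.

(** The defect of [1 - w] as a square root of [1 - q] is twice the next step of
    the iteration. *)
Lemma approx_sqrt x q (e : R) : opnorm_le x q 1 -> 0 < e ->
  exists v, opnorm_le x (v ^+ 2 - (1 - q)) e.
Proof.
move=> hq e0; have e2 : 0 < e / 2 by lra.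
have [N hN] := sqrt_iter_cauchy hq e2.
exists (1 - sqrt_iter q N).
have -> : (1 - sqrt_iter q N) ^+ 2 - (1 - q) =
    (2 : R) *: (sqrt_iter q N.+1 - sqrt_iter q N).
  rewrite sqrt_iter_step scalerBr scalerA divff// scale1r scaler_nat.
  by ring.
by have := opnormZ (ler0n R 2) (hN N.+1 N (leqnSn N) (leqnn N)); rewrite mulrC divfK.
Qed.

(** If [v^2] approximates [1 - c^2] then [v^2 + c^2] is almost [1], which
    bounds [v] by almost [1] because a square is dominated by a sum of
    commuting squares. *)
Lemma opnorm_1_sub_sqr x c : star x = x -> opnorm_le x c 1 ->
  opnorm_le x (1 - c ^+ 2) 1.
Proof.
move=> sx hc; apply: opnorm_closed => e e0.
have hc2 : opnorm_le x (c ^+ 2) 1 by rewrite -(mul1r 1) expr2; apply: opnormM.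
have e2 : 0 < e / 2 by lra.
have [v hv] := approx_sqrt hc2 e2.
have hvz z : nm (ev x v z) ^+ 2 <= (1 + e / 2) * nm z ^+ 2.
  have cm : star (ev x v z) ** ev x c z = star (ev x c z) ** ev x v z.
    by rewrite !ev_star// -!evM mulrC.
  apply: le_trans (nm_commuting_squares cm) _.
  rewrite !ev_star// -!evM -cmulDr -evD -!expr2.
  apply: le_trans (nmM _ _) _; rewrite nm_star expr2 mulrCA.
  rewrite ler_wpM2l ?nm_ge0//.
  have -> : v ^+ 2 + c ^+ 2 = 1%:P + (v ^+ 2 - (1 - c ^+ 2)).
    by rewrite polyC1; ring.
  by apply: opnormD; first exact: opnormC.
have hv2 : opnorm_le x (v ^+ 2) (1 + e / 2).
  move=> z; rewrite expr2 evM -(ler_pXn2r (n := 2))// ?nnegrE ?mulr_ge0 ?nm_ge0//;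
    last lra.
  apply: le_trans (hvz _) _; rewrite exprMn (expr2 (1 + _)) -mulrA.
  by apply: ler_wpM2l (hvz z); lra.
have -> : 1 - c ^+ 2 = v ^+ 2 + - (v ^+ 2 - (1 - c ^+ 2)) by ring.
have := opnormD hv2 (opnormN hv).
by rewrite -addrA -splitr.
Qed.

End PolyEval.

(** * Injective quotient maps are isometric *)

Section Distance.
Variables (R : realType) (A : cstarAlgType R).
Local Open Scope complex_scope.

Lemma sub_N (B : subCStarAlg A) x : sub_car B x -> sub_car B (- x).
Proof. by move=> Bx; rewrite -scaleN1r; exact: sub_Z. Qed.

Lemma sub_B (B : subCStarAlg A) x y :
  sub_car B x -> sub_car B y -> sub_car B (x - y).
Proof. by move=> Bx By; apply: sub_D Bx _; exact: sub_N. Qed.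

Lemma sub_ev (B : subCStarAlg A) x p z :
  sub_car B x -> sub_car B z -> sub_car B (ev x p z).
Proof.
move=> Bx Bz; elim/poly_ind : p => [|p c IH].
  by rewrite -[0]/(0%:P) evC scale0r; exact: sub_0.
by rewrite evD evMX evC; apply: sub_D; [exact: sub_mul|exact: sub_Z].
Qed.

Variables B I : subCStarAlg A.
Hypothesis idl : forall b i, sub_car B b -> sub_car I i -> sub_car I (b ** i).
Hypothesis idr : forall b i, sub_car B b -> sub_car I i -> sub_car I (i ** b).
Hypothesis BI0 : forall x, sub_car B x -> sub_car I x -> x = 0.

(** Polynomials respect congruence modulo [I]. *)
Lemma sub_ev_diff x x' p z z' : sub_car B x -> sub_car I (x - x') ->
  sub_car B z -> sub_car I (z - z') -> sub_car I (ev x p z - ev x' p z').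
Proof.
move=> Bx Ix Bz Iz; elim/poly_ind : p => [|p c IH].
  by rewrite -[0]/(0%:P) !evC !scale0r subr0; exact: sub_0.
rewrite !evD !evMX !evC opprD addrACA -scalerBr.
apply: sub_D; last exact: sub_Z.
have Bp := sub_ev p Bx Bz.
have -> : x ** ev x p z - x' ** ev x' p z' =
   (x ** (ev x p z - ev x' p z') + (x - x') ** ev x p z)
   - (x - x') ** (ev x p z - ev x' p z').
  rewrite !cmulBl !cmulBr opprB [RHS]addrC [RHS]addrA subrK.
  by rewrite [RHS]addrC addrA subrK.
apply: sub_B; last exact: sub_mul.
by apply: sub_D; [exact: idl|exact: idr].
Qed.

(** Suppose [r = |h^2 - i| < rho < 1 = |h^2|], and apply the functional calculus
    to the function [f(t) = t max(0, t - rho)]; the factor [t] removes constant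
    terms, so that [f(h^2)] is in [B]. Modulo [I], [f] is evaluated at an element
    of norm less than [rho], where it vanishes, so [f(h^2)] lies in [B] and in [I]
    and is zero. But then [h^2] acts on itself as if it were at most [rho], which
    contradicts [|h^2| = 1]. *)
Lemma dist_square h i : sub_car B h -> star h = h -> nm h = 1 ->
  sub_car I i -> star i = i -> 1 <= nm (h ** h - i).
Proof.
move=> Bh sh h1 Ii si; set a := h ** h; set a' := a - i.
rewrite leNgt; apply/negP => r1; set r := nm a' in r1.
have r0 : 0 <= r := nm_ge0 _.
have sa : star a = a by rewrite /a starM sh.
have sa' : star a' = a' by rewrite /a' starD starN sa si.
have Ba : sub_car B a := sub_mul Bh Bh.
have Iaa' : sub_car I (a - a') by rewrite /a' subKr.
have a1 : nm a = 1 by rewrite -(expr1n _ 2) -h1 -nm_star_mul sh.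
have [rho [rr r1']] : exists rho, r < rho /\ rho < 1.
  by exists ((1 + r) / 2); split; lra.
(* the factor 1/2 keeps the norm of c below 1 at a as well as at a' *)
pose c : {poly R} := (2^-1 : R) *: (rho%:P - 'X).
have rho0 : 0 <= rho by lra.
have hc x : nm x <= 1 -> opnorm_le x c 1.
  move=> x1; apply: opnorm_le_trans (_ : 2^-1 * (rho + nm x) <= 1); last by lra.
  apply: opnormZ; first by rewrite invr_ge0.
  by apply: opnormD; [exact: opnormC|apply: opnormN; exact: opnormX].
pose q := 1 - c ^+ 2; pose w := sqrt_iter q.
have qa : opnorm_le a q 1 by apply: opnorm_1_sub_sqr => //; apply: hc; rewrite a1.
have qa' : opnorm_le a' q 1 by apply: opnorm_1_sub_sqr => //; apply/hc/ltW.
pose b : {poly R} := 1 - c.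
(* the limit of f_n(t) = |t - rho| / 2 - (rho - t) / 2 is max(0, t - rho) *)
pose f n := b - w n.
(* with b = 1 - c one has q = 2 b - b^2, whose square-root iteration tends to b
   geometrically where the norm of b is less than 1, as it is at a' *)
have fS n : f n.+1 = (2^-1 : R) *: (f n * (b + w n)).
  have bE : b = (2^-1 : R) *: (2 *: b) by rewrite scalerA mulVf// scale1r.
  rewrite /f /w sqrt_iter_step {1}bE -scalerBr; congr (_ *: _).
  by rewrite scaler_nat /q /b; ring.
pose beta := 1 - rho / 2 + 2^-1 * r.
have beta1 : beta < 1 by rewrite /beta; lra.
have beta0 : 0 <= beta by rewrite /beta; lra.
have hb : opnorm_le a' b beta.
  have -> : b = (1 - rho / 2)%:P + (2^-1 : R) *: 'X.
    by rewrite /b /c -!mul_polyC polyCB polyCM polyC1; ring.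
  apply: opnormD; first by apply: opnormC; lra.
  by apply: opnormZ; [rewrite invr_ge0|exact: opnormX].
pose kappa := (beta + 1) / 2.
have kappa1 : `|kappa| < 1 by rewrite ger0_norm /kappa; lra.
have fa' n : opnorm_le a' (f n) (kappa ^+ n).
  elim: n => [|n IH].
    rewrite /f /w /= subr0 expr0; apply: opnorm_le_trans hb _; exact: ltW.
  have -> : kappa ^+ n.+1 = 2^-1 * (kappa ^+ n * (beta + 1)).
    by rewrite exprS {1}/kappa; field.
  rewrite fS; apply: opnormZ; first by rewrite invr_ge0.
  apply: opnormM => //; first by rewrite exprn_ge0// /kappa; lra.
  by apply: opnormD => //; exact: opnorm_sqrt_iter1.
pose g n := ev a (f n) a.
have [l gl] : exists l, forall e : R, 0 < e ->
    exists N, forall n, (N <= n)%N -> nm (g n - l) < e.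
  apply: nm_complete => e e0; have e2 : 0 < e / 2 by lra.
  have [N hN] := sqrt_iter_cauchy qa e2.
  exists N => m n Nm Nn; rewrite /g -evB.
  have -> : f m - f n = w n - w m by rewrite /f; ring.
  apply: le_lt_trans (hN _ _ Nn Nm a) _; rewrite a1; lra.
have Bg n : sub_car B (g n) := sub_ev (f n) Ba Ba.
have Bl : sub_car B l.
  apply: nm_closed; first exact: sub_closed.
  move=> e /gl[N /(_ N (leqnn N))]; rewrite nmB => gN.
  by exists (g N).
have Il : sub_car I l.
  apply: nm_closed; first exact: sub_closed.
  move=> e e0; have e2 : 0 < e / 2 by lra.
  have [N hN] := gl _ e2.
  have := cvg_expr kappa1; move=> /cvgrPdist_lt/(_ _ e2)[M _ hM].
  pose n := maxn N M.
  exists (g n - ev a' (f n) a').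
    by apply: sub_ev_diff.
  rewrite opprB addrC -addrA addrC.
  have h2 : nm (ev a' (f n) a') < e / 2.
    have := hM n (leq_maxr _ _); rewrite /= sub0r normrN normrX.
    apply: le_lt_trans; apply: le_trans (fa' n _) _.
    rewrite -/r ger0_norm; last by rewrite /kappa; lra.
    by rewrite ler_piMr ?(ltW r1)// exprn_ge0// /kappa; lra.
  have := hN n (leq_maxl _ _); have := nmD (- g n + l) (ev a' (f n) a').
  by rewrite (addrC (- _) l) (nmB l) (addrC (l - _)); lra.
have l0 : l = 0 := BI0 Bl Il.
pose e := (1 - rho) / 8.
have e0 : 0 < e by rewrite /e; lra.
have [n] := gl _ e0; move=> /(_ n (leqnn n)); rewrite l0 subr0 => gn.
have [u hu] := approx_sqrt (opnorm_sqrt_iter1 n qa) e0.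
(* h^2 + 2 u(a)^2 acts on a almost as multiplication by rho *)
pose s2 : R := Num.sqrt 2.
have s22 : s2 * s2 = 2 by rewrite -expr2 sqr_sqrtr.
have ha : h ** a = a ** h by rewrite /a cmulA.
pose v : {poly R} := s2 *: u.
have cm : star (h ** a) ** ev a v a = star (ev a v a) ** (h ** a).
  by rewrite starM sh sa ev_star// -(ev_comm v a ha) sa cmulA.
have := nm_commuting_squares cm; rewrite starM sh sa ev_star// -evM sa.
rewrite -(cmulA a h) -cmulDr (cmulA h h a) -/a -(evX a a) -evD.
have -> : 'X + v * v = rho%:P + ((2 : R) *: (u ^+ 2 - (1 - w n)) + (2 : R) *: f n).
  have vv : v * v = 2 * u ^+ 2.
    by rewrite /v -scalerAl -scalerAr scalerA s22 scaler_nat; ring.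
  have Xc : 'X = rho%:P - 2 * c :> {poly R}.
    have -> : 2 * c = (2 : R) *: c by rewrite scaler_nat mulr_natl.
    by rewrite /c scalerA divff// scale1r subKr.
  by rewrite vv [X in X + _]Xc !scaler_nat /f /b; ring.
rewrite !evD !evZ evC => hle.
have : nm (h ** a) ^+ 2 <= rho + 4 * e.
  apply: le_trans hle _; apply: le_trans (nmM _ _) _; rewrite a1 mul1r.
  apply: le_trans (nmD _ _) _; rewrite nmZ a1 ger0_norm// mulr1 lerD2l.
  apply: le_trans (nmD _ _) _; rewrite !nmZ ger0_norm//.
  have := hu a; rewrite a1; rewrite -/(g n); lra.
have : 1 <= nm (h ** a).
  have -> : 1 = nm (h ** (h ** a)) by rewrite cmulA -/a -{1}sa nm_star_mul a1 expr1n.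
  by apply: le_trans (nmM _ _) _; rewrite h1 mul1r.
rewrite /e; nra.
Qed.

Lemma nmZV (x : A) : x != 0 -> nm ((nm x)^-1%:C *: x) = 1.
Proof.
move=> x0; have : nm x != 0 by apply: contra x0 => /eqP/nm_eq0 ->.
by move=> n0; rewrite nmZ ger0_norm ?invr_ge0 ?nm_ge0// mulVf.
Qed.

(** An injective morphism of C*-algebras is isometric, for the map from [B] to
    the quotient by [I]. Passing from [b - i] to [(b - i)^* (b - i)] and then to
    its square reduces to a square of a self-adjoint element. *)
Lemma dist_ideal b i : sub_car B b -> sub_car I i -> nm b <= nm (b - i).
Proof.
suff norm1 x j : sub_car B x -> nm x = 1 -> sub_car I j -> 1 <= nm (x - j).
  move=> Bb Ii; have [->|b0] := eqVneq b 0; first by rewrite nm0 nm_ge0.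
  have nb : 0 < nm b.
    rewrite lt_neqAle nm_ge0 andbT eq_sym.
    by apply: contra b0 => /eqP/nm_eq0 ->.
  have := norm1 _ _ (sub_Z (nm b)^-1%:C Bb) (nmZV b0) (sub_Z (nm b)^-1%:C Ii).
  rewrite -scalerBr nmZ ger0_norm ?invr_ge0 ?nm_ge0// mulrC.
  by rewrite ler_pdivlMr// mul1r.
move=> Bx x1 Ij.
have Bsx := sub_star Bx; have Isj := sub_star Ij.
pose h := star x ** x.
pose k := star x ** j + star j ** x - star j ** j.
have sh : star h = h by rewrite /h starM starK.
have Bh : sub_car B h by exact: sub_mul.
have h1 : nm h = 1 by rewrite nm_star_mul x1 expr1n.
have Ik : sub_car I k.
  apply: sub_B; last exact: sub_mul.
  by apply: sub_D; [exact: idl|exact: idr].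
have sk : star k = k.
  by rewrite /k starD starN starD !starM !starK (addrC (star j ** x)).
have hk : star (x - j) ** (x - j) = h - k.
  by rewrite starD starN !cmulBl !cmulBr -addrA -opprD addrA.
have shk : star (h - k) = h - k by rewrite starD starN sh sk.
pose m := h ** k + k ** h - k ** k.
have Im : sub_car I m.
  apply: sub_B; last exact: sub_mul.
  by apply: sub_D; [exact: idl|exact: idr].
have sm : star m = m.
  by rewrite /m starD starN starD (starM h) !(starM k) sh sk (addrC (k ** h)).
have := dist_square Bh sh h1 Im sm.
have -> : h ** h - m = star (h - k) ** (h - k).
  by rewrite /m shk (cmulBl h k) !(cmulBr _ h k) -[RHS]addrA -opprD addrA.
by rewrite nm_star_mul -hk nm_star_mul -exprM expr_ge1 ?nm_ge0.
Qed.

(** [B + I] is closed: since the projection to [B] is contractive, a Cauchy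
    sequence in [B + I] has a Cauchy component in [B]. *)
Lemma sum_closed x :
  (forall e : R, 0 < e ->
     exists b i, [/\ sub_car B b, sub_car I i & nm (x - (b + i)) < e]) ->
  exists2 b, sub_car B b & sub_car I (x - b).
Proof.
move=> ap.
have ap' n : exists bi : A * A, [/\ sub_car B bi.1, sub_car I bi.2 &
    nm (x - (bi.1 + bi.2)) < n.+1%:R^-1].
  have [|b [i h]] := ap n.+1%:R^-1; first by rewrite invr_gt0.
  by exists (b, i).
have {ap ap'} [u hu] := choice ap'.
have small (e : R) : 0 < e -> exists N, forall n, (N <= n)%N ->
    nm (x - ((u n).1 + (u n).2)) < e.
  move=> e0; exists (Num.truncn e^-1) => n Nn.
  have [_ _ /lt_le_trans] := hu n; apply.
  rewrite invf_ple ?posrE//; apply/ltW/(lt_le_trans (truncnS_gt _)).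
  by rewrite ler_nat.
have [b bl] : exists l, forall e : R, 0 < e ->
    exists N, forall n, (N <= n)%N -> nm ((u n).1 - l) < e.
  apply: nm_complete => e e0; have [|N hN] := small (e / 2); first lra.
  exists N => m n Nm Nn.
  have [Bm Im _] := hu m; have [Bn In _] := hu n.
  apply: le_lt_trans (dist_ideal (sub_B Bm Bn) (sub_B In Im)) _.
  have -> : (u m).1 - (u n).1 - ((u n).2 - (u m).2) =
      (x - ((u n).1 + (u n).2)) - (x - ((u m).1 + (u m).2)).
    have subx (y z : A) : x - y - (x - z) = z - y.
      by rewrite opprB addrC addrA subrK.
    by rewrite subx opprB addrACA opprD.
  apply: le_lt_trans (nmD _ _) _; rewrite nmN.
  by have := hN _ Nm; have := hN _ Nn; lra.
exists b.
  apply: nm_closed; first exact: sub_closed.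
  move=> e /bl[N /(_ N (leqnn N))]; rewrite nmB => bN.
  by exists (u N).1 => //; have [] := hu N.
apply: nm_closed; first exact: sub_closed.
move=> e e0; have [|N hN] := small (e / 2); first lra.
have [|M hM] := bl (e / 2); first lra.
pose n := maxn N M; exists (u n).2; first by have [] := hu n.
have -> : x - b - (u n).2 = (x - ((u n).1 + (u n).2)) + ((u n).1 - b).
  by rewrite (addrC (u n).1) opprD !addrA addrNK addrAC.
apply: le_lt_trans (nmD _ _) _.
by have := hN _ (leq_maxl N M); have := hM _ (leq_maxr N M); lra.
Qed.

End Distance.

(** * Finite meet-stable sets of indices *)

Section MeetClosed.
Variables (d : Order.disp_t) (L : bMeetSemilatticeType d).
Implicit Types (s t : seq L) (i j k l m : L).

Definition meet_stable s :=
  forall i j, i \in s -> j \in s -> Order.meet i j \in s.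

(** If [t] is stable under meets, so is the union of [t], [l] and the meets of
    [l] with elements of [t]. *)
Lemma meet_stable_cover s :
  exists t, [/\ meet_stable t, {subset s <= t} & Order.bottom \in t].
Proof.
elim: s => [|l s [t [mt st t0]]].
  exists [:: Order.bottom]; split=> [i j||]//; last exact: mem_head.
  by rewrite !inE => /eqP-> /eqP->; rewrite meetxx.
pose u := l :: t ++ [seq Order.meet l j | j <- t].
have tu j : j \in t -> j \in u by rewrite inE mem_cat => ->; rewrite orbT.
have ltu j : j \in t -> Order.meet l j \in u.
  by move=> jt; rewrite inE mem_cat (map_f _ jt) !orbT.
have uP i : i \in u -> [\/ i = l, i \in t | exists2 j, j \in t & i = Order.meet l j].
  rewrite inE mem_cat => /orP[/eqP->|/orP[?|/mapP[j jt ->]]];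
    by [constructor 1|constructor 2|constructor 3; exists j].
exists u; split; last exact: tu.
- move=> i j /uP[->|it|[k kt ->]] /uP[->|jt|[m mu ->]].
  + by rewrite meetxx mem_head.
  + exact: ltu.
  + by rewrite meetA meetxx; exact: ltu.
  + by rewrite meetC; exact: ltu.
  + by apply/tu/mt.
  + by rewrite meetCA; apply/ltu/mt.
  + by rewrite meetAC meetxx; exact: ltu.
  + by rewrite -meetA; apply/ltu/mt.
  + by rewrite meetACA meetxx; apply/ltu/mt.
- by move=> i; rewrite inE => /orP[/eqP->|/st/tu//]; exact: mem_head.
Qed.

Lemma exists_maximal s i : i \in s ->
  exists2 m, m \in s & forall j, j \in s -> (m <= j)%O -> j = m.
Proof.
elim: s i => // l s IH i _.
case: s IH => [_|k s IH].
  by exists l => [|j]; rewrite inE// => /eqP.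
have [m ms mmax] := IH k (mem_head _ _).
have [ml|ml] := boolP (m < l)%O.
  exists l => [|j]; first exact: mem_head.
  rewrite inE => /orP[/eqP//|js lj].
  have jm := mmax j js (le_trans (ltW ml) lj).
  by move: lj; rewrite jm => /le_lt_trans/(_ ml); rewrite ltxx.
exists m => [|j]; first by rewrite inE ms orbT.
rewrite inE => /orP[/eqP->|/mmax//]; rewrite le_eqVlt (negPf ml) orbF.
by move=> /eqP.
Qed.

(** Induction on a finite meet-stable set of indices by removal of a maximal
    element [l], the meet of [l] with any other index being strictly below [l]. *)
Lemma meet_stable_ind (P : seq L -> Prop) :
  (forall s t, s =i t -> P s -> P t) -> P [::] ->
  (forall l s, l \notin s -> meet_stable s ->
    (forall j, j \in s -> Order.meet l j \in s) -> P s -> P (l :: s)) ->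
  forall s, meet_stable s -> P s.
Proof.
move=> Pext P0 Pcons s; have [n] := ubnP (size s).
elim: n s => // n IH s sn ms.
case: s sn ms => [//|k s] sn ms.
have [l ls lmax] := exists_maximal (mem_head k s).
pose t := [seq j <- k :: s | j != l].
have mlt i j : i \in t -> j \in k :: s -> Order.meet j i \in t.
  rewrite !mem_filter => /andP[il is_] js; rewrite ms// andbT.
  apply: contra il => /eqP jil.
  by apply/eqP/lmax => //; rewrite -jil leIr.
have mt : meet_stable t.
  by move=> i j; rewrite [in X in X -> _]mem_filter => /andP[_ is_] jt; exact: mlt.
have lt : l \notin t by rewrite mem_filter eqxx.
apply: (@Pext (l :: t)).
  move=> j; rewrite [LHS]inE mem_filter; have [->|] := eqVneq j l; first by rewrite ls.
  by [].
apply: Pcons => //; first by move=> j jt; exact: mlt.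
apply: IH => //; move: sn; rewrite ltnS; apply: leq_trans.
rewrite size_filter -(count_predC (pred1 l)) -[X in (X < _)%N]add0n ltn_add2r.
by rewrite -has_count has_pred1.
Qed.

End MeetClosed.

(** * Finite sums of components *)

Section GradedSums.
Variables (R : realType) (d : Order.disp_t) (L : bMeetSemilatticeType d).
Variables (A : cstarAlgType R) (A_ : L -> subCStarAlg A).
Implicit Types (s t : seq L) (i j k l m : L) (x y : A).

Fixpoint gsum s x : Prop :=
  if s is i :: s' then exists2 u, sub_car (A_ i) u & gsum s' (x - u) else x = 0.

Lemma gsum0 s : gsum s 0.
Proof.
by elim: s => // i s IH; exists 0; rewrite ?subr0//; exact: sub_0.
Qed.

Lemma gsumD s x y : gsum s x -> gsum s y -> gsum s (x + y).
Proof.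
elim: s x y => [|i s IH] x y /=; first by move=> -> ->; rewrite addr0.
move=> [u Au xu] [v Av yv]; exists (u + v); first exact: sub_D.
by rewrite opprD addrACA; exact: IH.
Qed.

Lemma gsum_component s i u : i \in s -> sub_car (A_ i) u -> gsum s u.
Proof.
move=> + Au; elim: s => // j s IH; rewrite inE => /orP[/eqP<-|/IH su].
  by exists u => //; rewrite subrr; exact: gsum0.
by exists 0; rewrite ?subr0//; exact: sub_0.
Qed.

Lemma gsum_ind s (P : A -> Prop) : P 0 -> (forall x y, P x -> P y -> P (x + y)) ->
  (forall i u, i \in s -> sub_car (A_ i) u -> P u) -> forall x, gsum s x -> P x.
Proof.
move=> P0 PD; elim: s => [_ x ->//|i s IH Pc x [u Au xu]].
rewrite -(subrK u x); apply: PD; last exact: Pc (mem_head _ _) Au.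
by apply: IH xu => j v js; apply: Pc; rewrite inE js orbT.
Qed.

Lemma gsum_sub s t x : {subset s <= t} -> gsum s x -> gsum t x.
Proof.
move=> st; apply: gsum_ind => [|y z|i u /st]; first exact: gsum0.
- exact: gsumD.
- exact: gsum_component.
Qed.

Lemma gsumZ s (a : R[i]) x : gsum s x -> gsum s (a *: x).
Proof.
move: x; apply: (gsum_ind (P := fun x => gsum s (a *: x))) => [|y z hy hz|i u si Au].
- by rewrite scaler0; exact: gsum0.
- by rewrite scalerDr; exact: gsumD.
- by apply: (gsum_component si); exact: sub_Z.
Qed.

Lemma gsumN s x : gsum s x -> gsum s (- x).
Proof. by rewrite -scaleN1r; exact: gsumZ. Qed.

Lemma gsum_star s x : gsum s x -> gsum s (star x).
Proof.
move: x; apply: (gsum_ind (P := fun x => gsum s (star x))) => [|y z hy hz|i u si Au].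
- by rewrite star0; exact: gsum0.
- by rewrite starD; exact: gsumD.
- by apply: (gsum_component si); exact: sub_star.
Qed.

Lemma gsum_split s m x : gsum s x ->
  exists2 w, sub_car (A_ m) w & gsum [seq i <- s | i != m] (x - w).
Proof.
move: x; apply: (gsum_ind (P := fun x => exists2 w, sub_car (A_ m) w &
  gsum [seq i <- s | i != m] (x - w))) => [|x y [v Av xv] [w Aw yw]|i u si Au].
- by exists 0; [exact: sub_0|rewrite subr0; exact: gsum0].
- exists (v + w); first exact: sub_D.
  by rewrite opprD addrACA; exact: gsumD.
- have [im|im] := eqVneq i m.
    by exists u; [rewrite -im|rewrite subrr; exact: gsum0].
  exists 0; first exact: sub_0.
  by rewrite subr0; apply: gsum_component Au; rewrite mem_filter im.
Qed.

Hypothesis grA : graded A_.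

Lemma gsum_mulr s k x y : gsum s x -> sub_car (A_ k) y ->
  gsum [seq Order.meet i k | i <- s] (x ** y).
Proof.
move=> + Ay; move: x; apply: (gsum_ind (P := fun x => gsum _ (x ** y)))
  => [|x z hx hz|i u si Au].
- by rewrite cmul0l; exact: gsum0.
- by rewrite cmulDl; exact: gsumD.
- by apply: gsum_component (graded_mul grA Au Ay); exact: map_f.
Qed.

Lemma gsum_mull s k x y : gsum s x -> sub_car (A_ k) y ->
  gsum [seq Order.meet k i | i <- s] (y ** x).
Proof.
move=> + Ay; move: x; apply: (gsum_ind (P := fun x => gsum _ (y ** x)))
  => [|x z hx hz|i u si Au].
- by rewrite cmul0r; exact: gsum0.
- by rewrite cmulDr; exact: gsumD.
- by apply: gsum_component (graded_mul grA Ay Au); exact: map_f.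
Qed.

Lemma gsum_mul s x y : meet_stable s -> gsum s x -> gsum s y -> gsum s (x ** y).
Proof.
move=> ms sx; move: y; apply: (gsum_ind (P := fun y => gsum s (x ** y)))
  => [|y z hy hz|k u sk Au].
- by rewrite cmul0r; exact: gsum0.
- by rewrite cmulDr; exact: gsumD.
- apply: gsum_sub (gsum_mulr sx Au) => _ /mapP[i si ->].
  exact: ms.
Qed.

Lemma gsum_indep s m x : m \notin s -> sub_car (A_ m) x -> gsum s x -> x = 0.
Proof.
move=> ms Ax sx.
have [S [AS S0 SE]] : exists S : L -> A, [/\ forall i, sub_car (A_ i) (S i),
    forall i, i \notin s -> S i = 0 & \sum_(i <- undup s) S i = x].
  move: x sx {Ax}; apply: (gsum_ind (P := fun x => exists S : L -> A,
        [/\ forall i, sub_car (A_ i) (S i), forall i, i \notin s -> S i = 0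
          & \sum_(i <- undup s) S i = x]))
  => [|y z [S [AS S0 <-]] [T [AT T0 <-]]|i u si Au].
  - exists (fun=> 0); split=> // [i|]; first exact: sub_0.
    by rewrite big1.
  - exists (fun i => S i + T i); split=> [i|i si|].
    + exact: sub_D.
    + by rewrite S0// T0// addr0.
    + by rewrite big_split.
  - exists (fun j => if j == i then u else 0); split=> [j|j|].
    + by case: eqP => [->//|_]; exact: sub_0.
    + by case: eqP => // ->; rewrite si.
    + rewrite (bigD1_seq i) ?undup_uniq ?mem_undup//= eqxx big1 ?addr0// => j.
      by move=> /negPf->.
pose T i := if i == m then - x else S i.
have T0 i : i \notin m :: undup s -> T i = 0.
  by rewrite inE mem_undup negb_or /T => /andP[/negPf-> /S0].
have TE : \sum_(i \in [set: L]) T i = 0.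
  rewrite -(fsbig_widen [set` m :: undup s])//=; last first.
    by move=> i [_ /negP/T0].
  rewrite -fsbig_seq/= ?mem_undup ?ms ?undup_uniq//.
  rewrite big_cons {1}/T eqxx -SE -sumrN -big_split big1_seq//= => i.
  rewrite mem_undup /T => /= si; case: eqP => [im|_]; last by rewrite addNr.
  by rewrite -im si in ms.
have : T m = 0.
  apply: (graded_indep grA _ _ TE) => [i|].
    by rewrite /T; case: eqP => [->|//]; exact: sub_N.
  apply: (@sub_finite_set _ _ [set` m :: undup s]); last exact: finite_seq.
  by move=> i /= /eqP; apply: contra_notT => /T0.
by rewrite /T eqxx => /eqP; rewrite oppr_eq0 => /eqP.
Qed.

End GradedSums.

(** * Extensionality of multipliers *)

Section MultiplierExt.
Variables (R : realType) (A : cstarAlgType R).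

Lemma multiplier_ext (S T : multiplier A) :
  mult_l S =1 mult_l T -> mult_r S =1 mult_r T -> S = T.
Proof.
case: S => sl sr a1 a2 a3 a4 a5 a6 a7; case: T => tl tr b1 b2 b3 b4 b5 b6 b7 /=.
move=> /funext lE /funext rE; subst tl tr; congr Multiplier; exact: Prop_irrelevance.
Qed.

Lemma cmul_star_eq0 (x : A) : x ** star x = 0 -> x = 0.
Proof.
move=> xx; have : nm (star x) ^+ 2 = 0 by rewrite -nm_star_mul starK xx nm0.
by move=> /eqP; rewrite expf_eq0 nm_star => /eqP/nm_eq0.
Qed.

End MultiplierExt.

(** * Injectivity on a graded algebra *)

Section Graded.
Variables (R : realType) (d : Order.disp_t) (L : bMeetSemilatticeType d).
Variables (A : cstarAlgType R) (A_ : L -> subCStarAlg A) (grA : graded A_).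
Implicit Types (s t : seq L) (i j k l m : L) (x y : A).

Definition gsum_alg s (ms : meet_stable s) (cs : closed (gsum A_ s)) :
    subCStarAlg A :=
  @SubCStarAlg R A (gsum A_ s) cs (gsum0 A_ s) (@gsumD _ _ _ _ A_ s)
    (@gsumZ _ _ _ _ A_ s) (fun x y => @gsum_mul _ _ _ _ A_ grA s x y ms)
    (@gsum_star _ _ _ _ A_ s).

(** When a maximal index [l] is added to [s], the sum over [s] is an ideal that
    meets [A_ l] trivially, so that [sum_closed] applies. *)
Lemma gsum_closed s : meet_stable s -> closed (gsum A_ s).
Proof.
move: s; apply: (meet_stable_ind (P := fun s => closed (gsum A_ s)))
  => [s t st cs||l s ls ms ml cs].
- suff -> : gsum A_ t = gsum A_ s by [].
  by apply/seteqP; split=> x; apply: gsum_sub => i; rewrite st.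
- apply: closed_nm => x h; apply: nm_eq0.
  apply/le_anti; rewrite nm_ge0 andbT; apply/ler_addgt0Pr => e e0.
  by have [_ -> ] := h e e0; rewrite subr0 add0r => /ltW.
- pose I := gsum_alg ms cs.
  have idl b v : sub_car (A_ l) b -> sub_car I v -> sub_car I (b ** v).
    move=> Ab Iv; apply: gsum_sub (gsum_mull grA Iv Ab).
    by move=> _ /mapP[j js ->]; exact: ml.
  have idr b v : sub_car (A_ l) b -> sub_car I v -> sub_car I (v ** b).
    move=> Ab Iv; apply: gsum_sub (gsum_mulr grA Iv Ab).
    by move=> _ /mapP[j js ->]; rewrite meetC; exact: ml.
  have BI0 x : sub_car (A_ l) x -> sub_car I x -> x = 0 by exact: gsum_indep.
  apply: closed_nm => x h; apply: (sum_closed idl idr BI0) => e e0.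
  have [y [u Au yu] xy] := h e e0.
  by exists u, (y - u); split => //; rewrite (addrC u) subrK.
Qed.

Hypothesis hA : forall (k l : L) (kl : (k < l)%O),
  structure_morphism grA (ltW kl) @^-1` range (@multiplier_emb R (A_ k)) = [set 0].

(** The hypothesis on the structure morphisms asks for an equality of double
    centralizers. Equality of the left actions suffices: it makes
    [z (u - w)] annihilate its own adjoint. *)
Lemma mult_inj k l u w : (k < l)%O -> sub_car (A_ l) u -> sub_car (A_ k) w ->
  (forall y, sub_car (A_ k) y -> (u - w) ** y = 0) -> u = 0.
Proof.
move=> kl Au Aw uw.
pose u' : A_ l := insub_alg Au.
suff : (structure_morphism grA (ltW kl) @^-1` range (@multiplier_emb R (A_ k))) u'.
  by rewrite hA => /(congr1 (@sub_val _ _ _)).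
exists (insub_alg Aw) => //; apply: multiplier_ext => z; apply: val_inj => /=.
  by apply/esym/eqP; rewrite -subr_eq0 -cmulBl uw//; exact: val_sub_car.
apply/esym/eqP; rewrite -subr_eq0 -cmulBr; apply/eqP.
set z0 := sub_val z; have Az : sub_car (A_ k) z0 := val_sub_car z.
apply: cmul_star_eq0; rewrite -cmulA uw ?cmul0r//.
apply: sub_star; rewrite cmulBr; apply: sub_B; last exact: sub_mul.
exact: (graded_idealizes grA (ltW kl) Au).2.
Qed.

(** By induction along [meet_stable_ind]: for [x] in [A_ l], the component of
    [a x] in [A_ l] acts on [A_ m] as an element of [A_ m], where [m] is maximal
    among the indices strictly below [l]. *)
Lemma gsum_annihilator s : meet_stable s -> Order.bottom \in s ->
  forall a, gsum A_ s a ->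
    (forall x, sub_car (A_ Order.bottom) x -> a ** x = 0) -> a = 0.
Proof.
move: s; apply: (meet_stable_ind (P := fun s => Order.bottom \in s ->
  forall a, gsum A_ s a ->
    (forall x, sub_car (A_ Order.bottom) x -> a ** x = 0) -> a = 0)).
- move=> s t st IH; rewrite -st => /IH {}IH a ta; apply: IH.
  by apply: gsum_sub ta => i; rewrite st.
- by [].
move=> l s ls ms ml IH.
move=> bs a sa aI.
have [l0|l0] := eqVneq l Order.bottom.
  case: s ls ms ml {IH bs} sa => [_ _ _|j s ls _ ml _].
    move=> [u Au /= /eqP]; rewrite subr_eq0 => /eqP au; subst u.
    by apply: cmul_star_eq0; apply: aI; apply: sub_star; rewrite -l0.
  by move: (ml j (mem_head _ _)); rewrite l0 meet0x -l0 (negPf ls).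
have {}bs : Order.bottom \in s by move: bs; rewrite inE eq_sym (negPf l0).
have [u Au sau] := sa; pose v := a - u.
have {sau} sv : gsum A_ s v := sau.
have av : a = u + v by rewrite /v addrC subrK.
suff u0 : u = 0 by apply: IH => //; rewrite av u0 add0r.
suff ux x : sub_car (A_ l) x -> u ** x = 0.
  by apply: cmul_star_eq0; apply: ux; exact: sub_star.
move=> Ax; pose G := [seq i <- s | (i < l)%O].
have bG : Order.bottom \in G by rewrite mem_filter bs andbT lt0x.
have [m mG mmax] := exists_maximal bG.
have [ml' msm] : (m < l)%O /\ m \in s by move: mG; rewrite mem_filter => /andP[].
have Gvx : gsum A_ G (v ** x).
  apply: gsum_sub (gsum_mulr grA sv Ax) => _ /mapP[i is_ ->].
  have lis : Order.meet i l \in s by rewrite meetC; exact: ml.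
  rewrite mem_filter lis andbT lt_neqAle leIr andbT.
  by apply: contraNneq ls => <-.
have [w Aw Gw] := gsum_split m Gvx.
apply: (mult_inj (w := - w) ml') => [||y Ay].
- by rewrite -(meetxx l); exact: (graded_mul grA).
- exact: sub_N.
rewrite opprK.
have Axy : sub_car (A_ m) (x ** y).
  by rewrite -(meet_idPr (ltW ml')); exact: (graded_mul grA).
(* a x y lies in the sum over s and annihilates the bottom component *)
have axy : a ** (x ** y) = 0.
  apply: IH => // [|z Iz].
    rewrite av cmulDl; apply: gsumD.
      apply: (gsum_component msm).
      by rewrite -(meet_idPr (ltW ml')); exact: (graded_mul grA).
    apply: gsum_sub (gsum_mulr grA sv Axy) => _ /mapP[i is_ ->]; exact: ms.
  rewrite -cmulA; apply: aI.
  by have := graded_mul grA Axy Iz; rewrite meetx0.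
have rest : gsum A_ [seq Order.meet i m | i <- G & i != m] ((v ** x - w) ** y).
  exact: gsum_mulr.
apply: (@gsum_indep _ _ _ _ A_ grA [seq Order.meet i m | i <- G & i != m] m).
- apply/negP; case/mapP => i; rewrite mem_filter => /andP[im iG] /esym/meet_idPr mi.
  by move: im; rewrite (mmax i iG mi) eqxx.
- rewrite cmulDl -cmulA; apply: sub_D.
    by rewrite -(meet_idPr (ltW ml')); exact: (graded_mul grA).
  by rewrite -(meetxx m); exact: (graded_mul grA).
have -> : (u ** x + w) ** y = - ((v ** x - w) ** y).
  apply/eqP; rewrite -addr_eq0 -cmulDl addrACA subrr addr0 -cmulDl -av -cmulA.
  by rewrite axy.
exact: gsumN.
Qed.

Definition annihilator (I : subCStarAlg A) : set A :=
  [set a | forall x, sub_car I x -> a ** x = 0 /\ x ** a = 0].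

Lemma annihilator_closed I : closed (annihilator I).
Proof.
have small (y : A) (C : R) : (forall e, 0 < e -> nm y <= e * C) -> y = 0.
  move=> h; apply/nm_eq0/le_anti; rewrite nm_ge0 andbT.
  have C1 : 0 < `|C| + 1 by rewrite ltr_wpDl.
  apply/ler_addgt0Pr => e e0; rewrite add0r.
  apply: le_trans (h (e / (`|C| + 1)) _) _; first by rewrite divr_gt0.
  rewrite mulrAC ler_pdivrMr// ler_pM2l//.
  by apply: le_trans (ler_norm _) _; rewrite lerDl.
apply: closed_nm => a h x Ix; split; apply: (small _ (nm x)) => e /h[b bI ab].
- have -> : a ** x = (a - b) ** x by rewrite cmulBl (bI x Ix).1 subr0.
  by apply: le_trans (nmM _ _) _; rewrite ler_wpM2r ?nm_ge0 ?ltW.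
- have -> : x ** a = x ** (a - b) by rewrite cmulBr (bI x Ix).2 subr0.
  by apply: le_trans (nmM _ _) _; rewrite mulrC ler_wpM2r ?nm_ge0 ?ltW.
Qed.

Definition annihilator_alg (I : subCStarAlg A) : subCStarAlg A.
Proof.
apply: (@SubCStarAlg R A (annihilator I) (@annihilator_closed I)).
- by move=> x Ix; rewrite cmul0l cmul0r.
- move=> a b aI bI x Ix; have [a1 a2] := aI x Ix; have [b1 b2] := bI x Ix.
  by rewrite cmulDl cmulDr a1 a2 b1 b2 addr0.
- move=> c a aI x Ix; have [a1 a2] := aI x Ix.
  by rewrite cmulZl cmulZr a1 a2 scaler0.
- move=> a b aI bI x Ix; have [a1 a2] := aI x Ix; have [b1 b2] := bI x Ix.
  by rewrite -cmulA b1 cmulA a2 cmul0l cmul0r.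
- move=> a aI x Ix; have [a1 a2] := aI _ (sub_star Ix).
  by rewrite -(starK x) -!starM a1 a2 star0.
Defined.

Lemma span_gsum a : lin_span (\bigcup_i sub_car (A_ i)) a ->
  exists s, [/\ meet_stable s, Order.bottom \in s & gsum A_ s a].
Proof.
move=> [n [c [v [Sv ->]]]].
have index o : exists k, sub_car (A_ k) (v o) by have [k _ kv] := Sv o; exists k.
have [k kv] := choice index.
have [s [ms ks bs]] := meet_stable_cover (map k (enum 'I_n)).
exists s; split=> //; elim/big_rec : _ => [|o x _ sx]; first exact: gsum0.
apply: gsumD sx; apply: gsumZ; apply: gsum_component (kv o).
by apply/ks/map_f; rewrite mem_enum.
Qed.

Lemma annihilator_eq0 a : annihilator (A_ Order.bottom) a -> a = 0.
Proof.
move=> aJ; apply/nm_eq0/le_anti; rewrite nm_ge0 andbT.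
apply/ler_addgt0Pr => e e0; rewrite add0r.
have e2 : 0 < (e / 2)%:C%C by rewrite ltcR divr_gt0.
have [||b [/= /ball_nm ab /span_gsum[s [ms bs sb]]]] :=
  graded_total grA (O := ball a (e / 2)%:C%C).
- by exists a; exact: ballxx.
- exact: ball_open.
pose B := gsum_alg ms (gsum_closed ms).
pose J := annihilator_alg (A_ Order.bottom).
have idl x v : sub_car B x -> sub_car J v -> sub_car J (x ** v).
  move=> _ Jv y Iy; split; first by rewrite -cmulA (Jv y Iy).1 cmul0r.
  by rewrite cmulA (Jv _ ((bottom_idealizes grA x).2 y Iy)).2.
have idr x v : sub_car B x -> sub_car J v -> sub_car J (v ** x).
  move=> _ Jv y Iy; split; last by rewrite cmulA (Jv y Iy).2 cmul0l.
  by rewrite -cmulA (Jv _ ((bottom_idealizes grA x).1 y Iy)).1.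
have BJ0 x : sub_car B x -> sub_car J x -> x = 0.
  by move=> Bx Jx; apply: (gsum_annihilator ms bs Bx) => y Iy; have [] := Jx y Iy.
have bb := @dist_ideal _ _ B J idl idr BJ0 b a sb aJ.
rewrite -(subrK b a); apply: le_trans (nmD _ _) _.
by rewrite (nmB b) in bb; lra.
Qed.

End Graded.

Theorem mainTheorem14 (R : realType) (d : Order.disp_t)
    (L : bMeetSemilatticeType d) (A : cstarAlgType R)
    (A_ : L -> subCStarAlg A) (grA : graded A_)
    (hA : forall (k l : L) (kl : (k < l)%O),
      structure_morphism grA (ltW kl) @^-1` range (@multiplier_emb R (A_ k))
        = [set 0]) :
  injective (bottom_morphism grA).
Proof.
move=> a b ab; apply/eqP; rewrite -subr_eq0; apply/eqP.
apply: (annihilator_eq0 hA) => x Ix; rewrite cmulBl cmulBr.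
have := congr1 (fun T => sub_val (mult_l T (insub_alg Ix))) ab.
have := congr1 (fun T => sub_val (mult_r T (insub_alg Ix))) ab.
by move=> /= -> ->; rewrite !subrr.
Qed.
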